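(* Let $m\in(0,1)$ be fixed. For every convex pentagon $K=ABCDE$ in the plane, let $M$, $N$, $P$, $Q$, $R$ be the points on the sides $AB$, $BC$, $CD$, $DE$, $EA$ respectively such that $AM:MB=BN:NC=CP:PD=DQ:QE=ER:RA=m:(1-m)$, and let $K'=MNPQR$. Then $$1-2m(1-m)<\frac{\Delta(K')}{\Delta(K)}<1-m(1-m).$$ Moreover, both the lower and the upper bound are best possible: for every $\epsilon>0$ there exists a convex pentagon $K$ with $\frac{\Delta(K')}{\Delta(K)}<1-2m(1-m)+\epsilon$, and there exists a convex pentagon $K$ with $\frac{\Delta(K')}{\Delta(K)}>1-m(1-m)-\epsilon$.
   Context: $\Delta(\cdot)$ denotes the area of a polygon. Vertices of a polygon are listed in cyclic order along its boundary, and convex polygons are nondegenerate (any three consecutive vertices form a triangle of positive area). The pentagon $K'$ is called the first $m$-Kasner descendant of $K$. The condition $AM:MB=m:(1-m)$ means that $M$ lies on segment $AB$ with $\overrightarrow{AM}=m\,\overrightarrow{AB}$, and similarly for the other points. *)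

(* Defs.v *)
From HB Require Import structures.
From mathcomp Require Import all_boot all_order all_algebra.
From mathcomp Require Import all_classical all_reals all_analysis.

Set Implicit Arguments.
Unset Strict Implicit.
Unset Printing Implicit Defensive.

Import Order.TTheory GRing.Theory Num.Theory.
Import numFieldNormedType.Exports.

Local Open Scope classical_set_scope.
Local Open Scope ring_scope.

(* An n-gon is the family of its vertices in cyclic order; the vertex following
   V i is V (ordS i), and the i-th side joins these two points. *)
Definition polygon (R : realType) (n : nat) : Type := 'I_n -> R * R.

(* Twice the signed area of the triangle ABC: positive, negative or zero
   according as C lies to the left of, to the right of, or on the line AB. *)
Definition orient (R : realType) (A B C : R * R) : R :=
  (B.1 - A.1) * (C.2 - A.2) - (B.2 - A.2) * (C.1 - A.1).

(* The line through each side leaves all the other vertices strictly on one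
   side. For n >= 3 that side is the same for all i, since
   orient (V i) (V (i+1)) (V (i+2)) is shared by the sides i and i+1; both
   orientations of the boundary are allowed. *)
Definition convex_polygon (R : realType) (n : nat) (V : polygon R n) : Prop :=
  forall i : 'I_n,
    (forall j, j != i -> j != ordS i -> 0 < orient (V i) (V (ordS i)) (V j)) \/
    (forall j, j != i -> j != ordS i -> orient (V i) (V (ordS i)) (V j) < 0).

Definition convex_hull (R : realType) (n : nat) (V : polygon R n) :
    set (R * R) :=
  [set p | exists w : 'I_n -> R,
    [/\ forall i, 0 <= w i, \sum_i w i = 1 & p = \sum_i w i *: V i]].

(* Planar Lebesgue measure of the closed region bounded by a convex polygon,
   which is the convex hull of its vertices; it is finite because the hull is
   bounded, so that fine loses nothing. *)
Definition area (R : realType) (n : nat) (V : polygon R n) : R :=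
  fine ((lebesgue_measure \x lebesgue_measure)%E (convex_hull V)).

(* The i-th vertex is the point M of the i-th side AB with AM = m AB. *)
Definition kasner_descendant (R : realType) (n : nat) (m : R)
    (V : polygon R n) : polygon R n :=
  fun i => V i + m *: (V (ordS i) - V i).

(* Main.v *)
Require Import Defs.
From HB Require Import structures.
From mathcomp Require Import all_boot all_order all_algebra.
From mathcomp Require Import all_classical all_reals all_analysis.
From mathcomp Require Import measurable_realfun.
From mathcomp Require Import ring lra zify.

Set Implicit Arguments.
Unset Strict Implicit.
Unset Printing Implicit Defensive.

Import Order.TTheory GRing.Theory Num.Theory.
Import numFieldNormedType.Exports.

(** Cutting off the five corner triangles shows that the descendant of [K] has
    area [F - m (1 - m) S], where [F] is the area of [K] and [S] the sum of the
    areas [e_i] of the ears [V_i V_(i+1) V_(i+2)]; so the claim is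
    [F < S < 2 F]. The lower bound follows from the identity of Gauss
    [F (S - F) = \sum_i e_i e_(i+1)], the upper one from a Pluecker relation
    among the triangles at one vertex. [S] tends to [2 F] when three vertices
    merge, and to [F] when two disjoint pairs of adjacent vertices merge.
    That areas are given by determinants follows by integrating the vertical
    sections of triangles with a vertical side, splitting any other triangle
    along a vertical line, and triangulating the pentagon as a fan. *)

Local Open Scope classical_set_scope.
Local Open Scope ring_scope.

Notation lambda2 := ((@lebesgue_measure _) \x (@lebesgue_measure _))%E.

(** * Areas of triangles *)

Lemma integral_deriv_poly (R : realType) (p : {poly R}) (a b : R) : a < b ->
  (\int[lebesgue_measure]_(x in `[a, b]) (p^`().[x])%:E = (p.[b] - p.[a])%:E)%E.
Proof.
move=> ab; rewrite (@continuous_FTC2 _ _ (horner p)) //.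
- by apply: continuous_subspaceT => x; exact: continuous_horner.
- split=> [x _| |].
  + exact: derivable_horner.
  + by apply: cvg_at_right_filter; exact: continuous_horner.
  + by apply: cvg_at_left_filter; exact: continuous_horner.
- by move=> x _; rewrite derivE.
Qed.

(** The section of [T] at [x] is a segment of length [h0 + h1 * x]; the product measure integrates
    this affine length over [[a, b]], which gives the width times the length at the midpoint. *)
Lemma area_trapezoid (R : realType) (T : set (R * R)) (a b f0 f1 h0 h1 : R) :
  a < b -> (forall x, a <= x <= b -> 0 <= h0 + h1 * x) ->
  (forall x y, T (x, y) <->
     a <= x <= b /\ f0 + f1 * x <= y <= f0 + f1 * x + (h0 + h1 * x)) ->
  lambda2 T = ((b - a) * (h0 + h1 * (a + b) / 2))%:E.
Proof.
move=> ab h_ge0 TE; rewrite /product_measure1.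
pose p : {poly R} := h0 *: 'X + (h1 / 2) *: 'X^2.
have pE x : p^`().[x] = h0 + h1 * x.
  rewrite /p derivD !derivZ derivX derivXn !hornerE /=.
  by lra.
transitivity (\int[@lebesgue_measure R]_x
    ((fun x => (p^`().[x])%:E) \_ `[a, b]) x)%E.
  apply: eq_integral => x _ /=; rewrite patchE.
  case: ifPn => [|] xab.
    move: xab; rewrite inE /= in_itv /= => xab.
    have -> : xsection T x =
        `[f0 + f1 * x, f0 + f1 * x + (h0 + h1 * x)]%classic.
      apply/seteqP; split => y /=; rewrite /xsection /= inE in_itv /=.
        by move=> /TE[].
      by move=> ?; apply/TE.
    rewrite lebesgue_measure_itv /= lte_fin pE ltrDl.
    (* The measure of an interval whose ends do not increase strictly is given as 0; by [h_ge0] this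
       is still the length of the section. *)
    case: ltP => [_|]; first by rewrite -EFinD addrAC subrr add0r.
    by move=> h_le0; congr EFin; apply/esym/le_anti; rewrite h_le0 h_ge0.
  suff -> : xsection T x = set0 by rewrite measure0.
  apply/seteqP; split => y //=; rewrite /xsection /= inE => /TE[xab' _].
  by move: xab; rewrite notin_setE /= in_itv.
rewrite -integral_mkcond integral_deriv_poly //; congr EFin.
by rewrite /p !hornerE /=; lra.
Qed.

Lemma measurable_orient_ge0 (R : realType) (s : R) (A B : R * R) :
  measurable [set p : R * R | 0 <= s * orient A B p].
Proof.
rewrite -[X in measurable X]setTI.
pose f (p : R * R) := s * orient A B p.
have mf : measurable_fun setT f.
  rewrite /f /orient.
  apply: measurable_funM => //.
  apply: measurable_funB; apply: measurable_funM => //;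
    by apply: measurable_funB.
have -> : [set p | 0 <= s * orient A B p] = f @^-1` `[0, +oo[%classic.
  by apply/seteqP; split => p /=; rewrite in_itv /= andbT.
exact: mf.
Qed.

Lemma measurable_orient_eq0 (R : realType) (A B : R * R) :
  measurable [set p : R * R | orient A B p = 0].
Proof.
have -> : [set p | orient A B p = 0] =
    [set p | 0 <= 1 * orient A B p] `&` [set p | 0 <= -1 * orient A B p].
  apply/seteqP; split => p /=; rewrite mul1r mulN1r oppr_ge0.
    by move=> ->.
  by move=> [? ?]; apply/le_anti/andP.
by apply: measurableI; exact: measurable_orient_ge0.
Qed.

(** A vertical line is a product with a null factor, and [0 * +oo = 0]; any other line meets every
    vertical in a single point. *)
Lemma line_null (R : realType) (A B : R * R) : A != B ->
  lambda2 [set p : R * R | orient A B p = 0] = 0%E.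
Proof.
move=> AB; have [AB1|AB1] := eqVneq A.1 B.1.
  have AB2 : B.2 - A.2 != 0.
    apply: contra AB; rewrite subr_eq0 => /eqP AB2.
    by rewrite -pair_eqE /pair_eq AB1 AB2 !eqxx.
  have -> : [set p | orient A B p = 0] = [set A.1] `*` setT.
    apply/seteqP; split => -[x y] /=; rewrite /orient AB1 subrr mul0r sub0r /=.
      move=> /eqP; rewrite oppr_eq0 mulf_eq0 (negbTE AB2) subr_eq0 /=.
      by move=> /eqP.
    by move=> [-> _]; rewrite subrr mulr0 oppr0.
  by rewrite product_measure1E//= lebesgue_measure_set1 mul0e.
rewrite /product_measure1; apply: integral0_eq => x _ /=.
have {}AB1 : B.1 - A.1 != 0 by rewrite subr_eq0 eq_sym.
suff -> : xsection [set p | orient A B p = 0] x =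
    [set A.2 + (B.2 - A.2) * (x - A.1) / (B.1 - A.1)].
  by rewrite lebesgue_measure_set1.
apply/seteqP; split => y; rewrite /xsection /= inE /= /orient /=.
  move=> /eqP; rewrite subr_eq0 => /eqP <-.
  by field.
by move=> ->; field.
Qed.

(** Pieces of a triangulation overlap along edges. Replacing [B] by [B \ A] discards only a null set
    and makes the union disjoint. *)
Lemma measureU_null d (T : measurableType d) (R : realType)
    (mu : {measure set T -> \bar R}) (A B N : set T) :
  measurable A -> measurable B -> measurable N -> A `&` B `<=` N ->
  mu N = 0%E -> mu (A `|` B) = (mu A + mu B)%E.
Proof.
move=> mA mB mN ABN N0.
have AB0 : mu (B `&` A) = 0%E.
  apply: (subset_measure0 _ mN) => //; first exact: measurableI.
  by rewrite setIC.
have -> : mu B = mu (B `\` A).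
  by rewrite (measureDI mu mB mA) [X in (_ + X)%E]AB0 adde0.
rewrite -measureU //.
- congr (mu _); apply/seteqP; split => x /=; last by tauto.
  by have [] := pselect (A x); tauto.
- exact: measurableD.
- by rewrite setDE setICA setICr setI0.
Qed.

Definition triangle (R : realType) (A B C : R * R) : set (R * R) :=
  [set p | exists a b c : R, [/\ 0 <= a, 0 <= b, 0 <= c, a + b + c = 1 &
    p = a *: A + b *: B + c *: C]].

(** The barycentric coordinates of a point are the determinants of the three triangles it spans with
    the edges, divided by that of [A B C]. The factor [s] covers both orientations at once. *)
Lemma triangle_orient (R : realType) (s : R) (A B C : R * R) :
  0 < s * orient A B C ->
  triangle A B C = [set p | 0 <= s * orient A B p] `&`
    [set p | 0 <= s * orient B C p] `&` [set p | 0 <= s * orient C A p].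
Proof.
case: A B C => [a1 a2] [b1 b2] [c1 c2] ABC.
have ABC0 : s * orient (a1, a2) (b1, b2) (c1, c2) != 0 by rewrite gt_eqF.
apply/seteqP; split => [p [a [b [c [a0 b0 c0 abc ->]]]]|[x y]] /=.
  rewrite /orient /= in ABC *.
  have aE : a = 1 - b - c by lra.
  subst a.
  split; first split.
  - apply: le_trans (mulr_ge0 c0 (ltW ABC)) _.
    by rewrite le_eqVlt; apply/predU1P; left; rewrite /GRing.scale /=; ring.
  - apply: le_trans (mulr_ge0 a0 (ltW ABC)) _.
    by rewrite le_eqVlt; apply/predU1P; left; rewrite /GRing.scale /=; ring.
  - apply: le_trans (mulr_ge0 b0 (ltW ABC)) _.
    by rewrite le_eqVlt; apply/predU1P; left; rewrite /GRing.scale /=; ring.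
move=> [[pc pa] pb].
set T := s * orient (a1, a2) (b1, b2) (c1, c2) in ABC ABC0.
exists (s * orient (b1, b2) (c1, c2) (x, y) / T).
exists (s * orient (c1, c2) (a1, a2) (x, y) / T).
exists (s * orient (a1, a2) (b1, b2) (x, y) / T).
split; try by rewrite divr_ge0 // ltW.
  rewrite -!mulrDl -[RHS](divff ABC0); congr (_ / T).
  by rewrite /T /orient /=; ring.
rewrite /T in ABC0 *.
have [s0 D0] : s != 0 /\ orient (a1, a2) (b1, b2) (c1, c2) != 0.
  by apply/andP; rewrite -negb_or -mulf_eq0.
rewrite /orient /= in D0 *.
congr pair; rewrite /= -![_ *: _]/(_ * _); field; exact/andP.
Qed.

Lemma area_setU_line (R : realType) (X Y : set (R * R)) (A B : R * R) :
  measurable X -> measurable Y -> A != B ->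
  X `&` Y `<=` [set p | orient A B p = 0] ->
  lambda2 (X `|` Y) = (lambda2 X + lambda2 Y)%E.
Proof.
move=> mX mY AB XY.
pose mu := [the {measure set (_ * _) -> \bar R} of
  (@lebesgue_measure R \x @lebesgue_measure R)%E].
exact: (measureU_null (mu := mu) mX mY (measurable_orient_eq0 A B) XY
          (line_null AB)).
Qed.

Lemma triangle_rot (R : realType) (A B C : R * R) :
  triangle A B C = triangle B C A.
Proof.
apply/seteqP; split=> p [a [b [c [a0 b0 c0 abc ->]]]].
  exists b, c, a; split => //; last by rewrite -addrA addrC.
  by rewrite addrC addrA.
exists c, a, b; split => //; last by rewrite addrC addrA.
by rewrite -addrA addrC.
Qed.

Lemma triangle_swap (R : realType) (A B C : R * R) :
  triangle A B C = triangle A C B.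
Proof.
by apply/seteqP; split=> p [a [b [c [a0 b0 c0 abc ->]]]];
  exists a, c, b; split => //; rewrite -?abc addrAC.
Qed.

Lemma orient_rot (R : realType) (A B C : R * R) : orient A B C = orient B C A.
Proof. by rewrite /orient; ring. Qed.

Lemma orient_swap (R : realType) (A B C : R * R) :
  orient A B C = - orient A C B.
Proof. by rewrite /orient; ring. Qed.

Lemma orient0_neq (R : realType) (A B C : R * R) : orient A B C != 0 -> A != B.
Proof. by apply: contraNneq => ->; rewrite /orient !subrr !mul0r subrr. Qed.

Lemma sqr_orient_gt0 (R : realType) (A B C : R * R) : orient A B C != 0 ->
  0 < orient A B C * orient A B C.
Proof. by move=> ABC; rewrite -expr2 exprn_even_gt0. Qed.

Lemma measurable_triangle (R : realType) (A B C : R * R) :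
  orient A B C != 0 -> measurable (triangle A B C).
Proof.
move=> ABC; rewrite (triangle_orient (sqr_orient_gt0 ABC)).
by apply: measurableI; [apply: measurableI|]; exact: measurable_orient_ge0.
Qed.

(** This is a trapezoid degenerating to a point at [A]: the vertical sections run between the lines
    [A B] and [A C]. *)
Lemma area_vertical_triangle (R : realType) (A B C : R * R) : B.1 = C.1 ->
  orient A B C != 0 -> lambda2 (triangle A B C) = (`|orient A B C| / 2)%:E.
Proof.
wlog : B C / B.2 <= C.2 => [hw|BC2] BC1 ABC0.
  have [|/ltW] := leP B.2 C.2; first by move=> ?; exact: hw.
  move=> CB; rewrite triangle_swap orient_swap normrN hw //.
  by rewrite orient_swap oppr_eq0.
case: A B C BC1 BC2 ABC0 => [p q] [x0 y1] [_ y2] /= <- y12 ABC0.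
set d := x0 - p.
have ABC : orient (p, q) (x0, y1) (x0, y2) = d * (y2 - y1).
  by rewrite /orient /d /=; ring.
move: ABC0; rewrite ABC mulf_eq0 negb_or => /andP[d0].
rewrite subr_eq0 => y21; have {y21}y12 : 0 < y2 - y1.
  by rewrite subr_gt0 lt_neqAle eq_sym y21.
(* Scaling by the inverse of [d] makes the determinant the positive height [y2 - y1], on whichever
   side of the vertical edge [A] lies. *)
have sABC : 0 < d^-1 * orient (p, q) (x0, y1) (x0, y2).
  by rewrite ABC mulKf.
(* [f0 + f1 * x] is the line [A B], and [h0 + h1 * x] the length of the section, which grows from 0
   at [p] to [y2 - y1] at [x0]. *)
pose f1 := (y1 - q) / d; pose f0 := q - f1 * p.
pose h1 := (y2 - y1) / d; pose h0 := - (h1 * p).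
have TE x y : triangle (p, q) (x0, y1) (x0, y2) (x, y) <->
    (0 <= (x - p) / d <= 1 /\ f0 + f1 * x <= y <= f0 + f1 * x + (h0 + h1 * x)).
  rewrite (triangle_orient sABC) /=.
  have -> : d^-1 * orient (p, q) (x0, y1) (x, y) = y - (f0 + f1 * x).
    by rewrite /orient /f0 /f1 /=; rewrite /d in d0 *; field.
  have -> : d^-1 * orient (x0, y1) (x0, y2) (x, y) =
      (y2 - y1) * (1 - (x - p) / d).
    by rewrite /orient /=; rewrite /d in d0 *; field.
  have -> : d^-1 * orient (x0, y2) (p, q) (x, y) =
      f0 + f1 * x + (h0 + h1 * x) - y.
    by rewrite /orient /f0 /f1 /h0 /h1 /=; rewrite /d in d0 *; field.
  have hE : h0 + h1 * x = (y2 - y1) * ((x - p) / d).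
    by rewrite /h0 /h1; field.
  rewrite pmulr_rge0 // !subr_ge0 hE.
  split=> [[[fy t1] yg]|[/andP[t0 t1] /andP[fy yg]]] //.
  (* The remaining bound [0 <= (x - p) / d] holds because a section containing [y] has nonnegative
     length. *)
  rewrite t1 fy yg !andbT; split => //.
  by rewrite -(pmulr_rge0 _ y12); lra.
have [d_gt0|d_lt0] : 0 < d \/ d < 0 by apply/orP; rewrite orbC -neq_lt.
  rewrite (@area_trapezoid _ _ p x0 f0 f1 h0 h1).
  - congr EFin; rewrite gtr0_norm ?mulr_gt0 // /h0 /h1.
    by rewrite /d in d0 *; field.
  - by rewrite -subr_gt0.
  - move=> x /andP[px xx0].
    have -> : h0 + h1 * x = (y2 - y1) * ((x - p) / d) by rewrite /h0 /h1; field.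
    apply: mulr_ge0; first exact: ltW.
    by apply: divr_ge0; [rewrite subr_ge0|exact: ltW].
  - move=> x y; rewrite TE; rewrite ler_pdivlMr // mul0r ler_pdivrMr // mul1r.
    by rewrite subr_ge0 /d lerD2r.
rewrite (@area_trapezoid _ _ x0 p f0 f1 h0 h1).
- congr EFin; rewrite ltr0_norm ?nmulr_rlt0 // /h0 /h1.
  by rewrite /d in d0 *; field.
- by rewrite -subr_lt0.
- move=> x /andP[px xx0].
  have -> : h0 + h1 * x = (y2 - y1) * ((x - p) / d) by rewrite /h0 /h1; field.
  apply: mulr_ge0; first exact: ltW.
  by rewrite mulr_le0 ?subr_le0 // invr_le0 ltW.
- move=> x y; rewrite TE; rewrite ler_ndivlMr // mul0r ler_ndivrMr // mul1r.
  by rewrite subr_le0 /d lerD2r andbC.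
Qed.

(** The line [B D] cuts the triangle, and the sign of [orient B D p] decides the piece. Listing the
    second piece as [C D B] gives both pieces the orientation of the whole. *)
Lemma triangle_split (R : realType) (r : R) (A B C D : R * R) :
  0 < r -> r < 1 -> D = (1 - r) *: A + r *: C -> orient A B C != 0 ->
  [/\ orient A B D = r * orient A B C, orient C D B = (1 - r) * orient A B C &
    triangle A B C = triangle A B D `|` triangle C D B].
Proof.
move=> r0 r1 DE ABC.
have ABDp : orient A B D = r * orient A B C.
  by rewrite DE /orient /= -![_ *: _]/(_ * _); ring.
have CDBp : orient C D B = (1 - r) * orient A B C.
  by rewrite DE /orient /= -![_ *: _]/(_ * _); ring.
have r1' : 0 < 1 - r by rewrite subr_gt0.
split => //; set s := orient A B C.
have sABC : 0 < s * orient A B C by exact: sqr_orient_gt0.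
have sABD : 0 < s * orient A B D by rewrite ABDp mulrCA mulr_gt0.
have sCDB : 0 < s * orient C D B by rewrite CDBp mulrCA mulr_gt0.
rewrite (triangle_orient sABC) (triangle_orient sABD) (triangle_orient sCDB).
have BDE p : s * orient B D p =
    r * (s * orient B C p) - (1 - r) * (s * orient A B p).
  by rewrite DE /orient /= -![_ *: _]/(_ * _); ring.
have DAE p : s * orient D A p = r * (s * orient C A p).
  by rewrite DE /orient /= -![_ *: _]/(_ * _); ring.
have CDE p : s * orient C D p = (1 - r) * (s * orient C A p).
  by rewrite DE /orient /= -![_ *: _]/(_ * _); ring.
have DBE p : s * orient D B p = - (s * orient B D p).
  by rewrite /orient; ring.
apply/seteqP; split => p /=; rewrite DAE CDE DBE BDE (pmulr_rge0 _ r0)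
  (pmulr_rge0 _ r1').
  move=> [[pc pa] pb].
  have [BD|BD] := leP ((1 - r) * (s * orient A B p)) (r * (s * orient B C p)).
    by left; split; [split|] => //; rewrite subr_ge0.
  by right; split; [split|] => //; rewrite oppr_ge0 subr_le0 ltW.
move=> [[[pc BD] pb]|[[pb BD] pa]]; split=> //; split => //.
  by rewrite -(pmulr_rge0 _ r0); have := mulr_ge0 (ltW r1') pc; lra.
by rewrite -(pmulr_rge0 _ r1'); have := mulr_ge0 (ltW r0) pa; lra.
Qed.

Lemma area_triangle (R : realType) (A B C : R * R) : orient A B C != 0 ->
  lambda2 (triangle A B C) = (`|orient A B C| / 2)%:E.
Proof.
have sorted : forall A B C : R * R, A.1 <= B.1 -> B.1 <= C.1 ->
    orient A B C != 0 -> lambda2 (triangle A B C) = (`|orient A B C| / 2)%:E.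
  move=> {}A {}B {}C AB BC ABC0.
  have [BC1|BC1] := eqVneq B.1 C.1; first exact: area_vertical_triangle.
  have [AB1|AB1] := eqVneq A.1 B.1.
    rewrite -triangle_rot -orient_rot area_vertical_triangle //.
    by rewrite orient_rot.
  have {}AB : A.1 < B.1 by rewrite lt_neqAle AB1.
  have {}BC : B.1 < C.1 by rewrite lt_neqAle BC1.
  have AC : 0 < C.1 - A.1 by rewrite subr_gt0 (lt_trans AB).
  (* This ratio puts [D] on [A C] vertically above or below the middle vertex [B], so both pieces
     have the vertical side [B D]. *)
  pose r := (B.1 - A.1) / (C.1 - A.1).
  have r0 : 0 < r by rewrite divr_gt0 // subr_gt0.
  have r1 : r < 1 by rewrite ltr_pdivrMr // mul1r ltrD2r.
  pose D := (1 - r) *: A + r *: C.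
  have DB : D.1 = B.1.
    rewrite /D /= -![_ *: _]/(_ * _) /r; field; exact: lt0r_neq0.
  have [ABD CDB ->] := triangle_split r0 r1 (erefl D) ABC0.
  have ABD0 : orient A B D != 0 by rewrite ABD mulf_neq0 // gt_eqF.
  have CDB0 : orient C D B != 0 by rewrite CDB mulf_neq0 // gt_eqF // subr_gt0.
  rewrite (@area_setU_line _ _ _ B D).
  - rewrite !area_vertical_triangle // -EFinD ABD CDB.
    rewrite (normrM r) (normrM (1 - r)).
    rewrite (gtr0_norm r0) (@gtr0_norm _ (1 - r)) ?subr_gt0 //.
    by congr EFin; ring.
  - exact: measurable_triangle.
  - exact: measurable_triangle.
  - by apply: (@orient0_neq _ _ _ A); rewrite -orient_rot.
  - have sABD := sqr_orient_gt0 ABC0.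
    rewrite (@triangle_orient _ (orient A B C) A B D); last first.
      by rewrite ABD mulrCA mulr_gt0.
    rewrite (@triangle_orient _ (orient A B C) C D B); last first.
      by rewrite CDB mulrCA mulr_gt0 // subr_gt0.
    move=> p /= [[[_ BD] _] [[_ DB'] _]].
    have : orient A B C * orient B D p = 0.
      apply/le_anti; rewrite BD andbT -oppr_ge0.
      by move: DB'; congr (0 <= _); rewrite /orient; ring.
    by move=> /eqP; rewrite mulf_eq0 (negbTE ABC0) => /eqP.
(* The formula is invariant under permutation of the vertices, so they may be sorted by abscissa. *)
pose P (X Y Z : R * R) := orient X Y Z != 0 ->
  lambda2 (triangle X Y Z) = (`|orient X Y Z| / 2)%:E.
have swap X Y Z : P X Z Y -> P X Y Z.
  by rewrite /P triangle_swap (orient_swap X Y) normrN oppr_eq0.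
have rot X Y Z : P X Y Z -> P Y Z X.
  by rewrite /P triangle_rot (orient_rot X).
rewrite -/(P A B C).
have [AB|/ltW BA] := leP A.1 B.1; have [BC|/ltW CB] := leP B.1 C.1.
- exact: sorted.
- have [AC|/ltW CA] := leP A.1 C.1; first exact/swap/sorted.
  exact/rot/sorted.
- have [AC|/ltW CA] := leP A.1 C.1; last exact/rot/rot/sorted.
  exact/swap/rot/sorted.
- exact/swap/rot/rot/sorted.
Qed.

(** * Convex pentagons *)

Lemma sub_triangle_hull (R : realType) n (V : polygon R n) i j k :
  triangle (V i) (V j) (V k) `<=` convex_hull V.
Proof.
move=> _ [a [b [c [a0 b0 c0 abc ->]]]].
have sum1 (x : R) (l0 : 'I_n) : \sum_l x * (l == l0)%:R = x.
  rewrite (bigD1 l0) //= eqxx mulr1 big1 ?addr0 // => l /negbTE ->.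
  by rewrite mulr0.
have sumZ (x : R) (l0 : 'I_n) : \sum_l (x * (l == l0)%:R) *: V l = x *: V l0.
  rewrite (bigD1 l0) //= eqxx mulr1 big1 ?addr0 // => l /negbTE ->.
  by rewrite mulr0 scale0r.
exists (fun l => a * (l == i)%:R + b * (l == j)%:R + c * (l == k)%:R); split.
- by move=> l; rewrite !addr_ge0 ?mulr_ge0 ?ler0n.
- by rewrite !big_split /= !sum1.
- under eq_bigr do rewrite !scalerDl.
  by rewrite !big_split /= !sumZ.
Qed.

Lemma orient_barycenter (R : realType) n (V : polygon R n) (A B : R * R)
    (w : 'I_n -> R) : \sum_i w i = 1 ->
  orient A B (\sum_i w i *: V i) = \sum_i w i * orient A B (V i).
Proof.
move=> w1.
have fstE : (\sum_i w i *: V i).1 = \sum_i w i * (V i).1.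
  by rewrite (big_morph fst (fun _ _ => erefl) (erefl : (0 : R * R).1 = 0)).
have sndE : (\sum_i w i *: V i).2 = \sum_i w i * (V i).2.
  by rewrite (big_morph snd (fun _ _ => erefl) (erefl : (0 : R * R).2 = 0)).
rewrite /orient fstE sndE.
transitivity ((B.1 - A.1) * (\sum_i w i * (V i).2)
    - (B.2 - A.2) * (\sum_i w i * (V i).1)
    - ((B.1 - A.1) * A.2 - (B.2 - A.2) * A.1) * \sum_i w i).
  by rewrite w1; ring.
by rewrite !mulr_sumr -!sumrB; apply: eq_bigr => i _; ring.
Qed.

Lemma hull_orient_ge0 (R : realType) n (V : polygon R n) (s : R)
    (A B p : R * R) :
  (forall i, 0 <= s * orient A B (V i)) -> convex_hull V p ->
  0 <= s * orient A B p.
Proof.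
move=> ABV [w [w0 w1 ->]]; rewrite orient_barycenter // mulr_sumr.
by apply: sumr_ge0 => i _; rewrite mulrCA mulr_ge0.
Qed.

Lemma triangle_orient_ge0 (R : realType) (s : R) (X Y A B C p : R * R) :
  0 <= s * orient X Y A -> 0 <= s * orient X Y B -> 0 <= s * orient X Y C ->
  triangle A B C p -> 0 <= s * orient X Y p.
Proof.
move=> XYA XYB XYC [a [b [c [a0 b0 c0 abc ->]]]].
have -> : s * orient X Y (a *: A + b *: B + c *: C) =
    a * (s * orient X Y A) + b * (s * orient X Y B) + c * (s * orient X Y C).
  have aE : a = 1 - b - c by lra.
  by rewrite aE /orient /= -![_ *: _]/(_ * _); ring.
by rewrite !addr_ge0 // mulr_ge0.
Qed.

(* The boundary is convex and is traversed counterclockwise or clockwise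
   according to the sign of [s]. *)
Definition oriented (R : realType) n (s : R) (V : polygon R n) : Prop :=
  forall i j k : 'I_n, (i < j < k)%N -> 0 < s * orient (V i) (V j) (V k).

Lemma orientxx (R : realType) (A B : R * R) :
  (orient A A B = 0) * (orient A B A = 0) * (orient A B B = 0).
Proof. by rewrite /orient; split; [split|]; ring. Qed.

Lemma oriented_ge0 (R : realType) n (s : R) (V : polygon R n) (i j k : 'I_n) :
  oriented s V -> (i <= j <= k)%N -> 0 <= s * orient (V i) (V j) (V k).
Proof.
move=> sV /andP[]; rewrite leq_eqVlt => /predU1P[/val_inj ->|ij].
  by rewrite orientxx mulr0.
rewrite leq_eqVlt => /predU1P[/val_inj ->|jk]; first by rewrite orientxx mulr0.
by apply/ltW/sV/andP.
Qed.

Notation o5 k := (@Ordinal 5 k isT).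

(** The fan from [A] is the hull: the five side inequalities hold on the hull, and the two diagonals
    at [A] supply the missing ones. *)
Lemma area_pentagon (R : realType) (s : R) (V : polygon R 5) : oriented s V ->
  area V = (`|orient (V (o5 0)) (V (o5 1)) (V (o5 2))|
          + `|orient (V (o5 0)) (V (o5 2)) (V (o5 3))|
          + `|orient (V (o5 0)) (V (o5 3)) (V (o5 4))|) / 2.
Proof.
move=> sV.
set A := V (o5 0); set B := V (o5 1); set C := V (o5 2).
set D := V (o5 3); set E := V (o5 4).
have ABC : 0 < s * orient A B C by exact: sV.
have ACD : 0 < s * orient A C D by exact: sV.
have ADE : 0 < s * orient A D E by exact: sV.
have ne0 X Y Z : 0 < s * orient X Y Z -> orient X Y Z != 0.
  by apply: contraTneq => ->; rewrite mulr0 ltxx.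
have side (i j : 'I_5) p : j = i.+1 :> nat -> convex_hull V p ->
    0 <= s * orient (V i) (V j) p.
  move=> ij; apply: hull_orient_ge0 => l.
  have [li|il] := leqP l i.
    by rewrite -orient_rot oriented_ge0 // li ij leqnSn.
  by apply: oriented_ge0; rewrite // ij leqnSn.
have hullE : convex_hull V =
    triangle A B C `|` (triangle A C D `|` triangle A D E).
  apply/seteqP; split => p; last first.
    by move=> [|[|]]; exact: sub_triangle_hull.
  move=> Vp.
  have ABp : 0 <= s * orient A B p by exact: side.
  have BCp : 0 <= s * orient B C p by exact: side.
  have CDp : 0 <= s * orient C D p by exact: side.
  have DEp : 0 <= s * orient D E p by exact: side.
  have EAp : 0 <= s * orient E A p.
    apply: hull_orient_ge0 Vp => l; rewrite orient_rot.
    by apply: oriented_ge0 => //=; rewrite -ltnS.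
  rewrite (triangle_orient ABC) (triangle_orient ACD) (triangle_orient ADE) /=.
  have opp X : s * orient X A p = - (s * orient A X p).
    by rewrite /orient; ring.
  (* The diagonals [A C] and [A D] divide the hull into three sectors at [A], one for each triangle
     of the fan. *)
  have [ACp|ACp] := leP (s * orient A C p) 0.
    by left; split => //; rewrite opp oppr_ge0.
  right; have [ADp|ADp] := leP (s * orient A D p) 0.
    by left; split; [split|] => //; rewrite ?opp ?oppr_ge0 // ltW.
  by right; split; [split|] => //; rewrite ltW.
have AB : A != B by exact: orient0_neq (ne0 _ _ _ ABC).
have AC : A != C by exact: orient0_neq (ne0 _ _ _ ACD).
have AD : A != D by exact: orient0_neq (ne0 _ _ _ ADE).
have mABC : measurable (triangle A B C).
  exact: measurable_triangle (ne0 _ _ _ ABC).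
have mACD : measurable (triangle A C D).
  exact: measurable_triangle (ne0 _ _ _ ACD).
have mADE : measurable (triangle A D E).
  exact: measurable_triangle (ne0 _ _ _ ADE).
have s0 : s != 0 by move: ABC; apply: contraTneq => ->; rewrite mul0r ltxx.
have on_line X Y p : 0 <= s * orient X Y p -> 0 <= s * orient Y X p ->
    orient X Y p = 0.
  have -> : s * orient Y X p = - (s * orient X Y p) by rewrite /orient; ring.
  rewrite oppr_ge0 => p0 n0; apply/eqP.
  have : s * orient X Y p == 0 by rewrite eq_le p0 n0.
  by rewrite mulf_eq0 (negbTE s0).
rewrite /area hullE (@area_setU_line _ _ _ A C) //; last 2 first.
- exact: measurableU.
- move=> p [ABCp ACDEp]; apply: on_line.
    have [ACC ACA] : 0 <= s * orient A C C /\ 0 <= s * orient A C A.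
      by rewrite !orientxx mulr0.
    have ACE : 0 < s * orient A C E by exact: sV.
    by case: ACDEp; apply: triangle_orient_ge0 => //; exact: ltW.
  by move: ABCp; rewrite (triangle_orient ABC) => -[[]].
rewrite (@area_setU_line _ _ _ A D) //; last first.
  rewrite (triangle_orient ACD) (triangle_orient ADE).
  by move=> p [[[_ _] DAp] [[ADp _] _]]; exact: on_line.
rewrite !area_triangle ?ne0 //=.
by lra.
Qed.

Lemma ordS_pentagon : (ordS (o5 0) = o5 1) * (ordS (o5 1) = o5 2) *
  (ordS (o5 2) = o5 3) * (ordS (o5 3) = o5 4) * (ordS (o5 4) = o5 0).
Proof. by do 4![split; last exact: val_inj]; exact: val_inj. Qed.

Lemma val_ordS n (i : 'I_n) : val (ordS i) = if (i.+1 < n)%N then i.+1 else 0%N.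
Proof.
rewrite /=; case: ltnP => [/modn_small //|ni].
have nE : i.+1 = n by apply/eqP; rewrite eqn_leq ni ltn_ord.
by rewrite [X in (X %% _)%N]nE modnn.
Qed.

(** The signs prescribed side by side become one sign common to all increasing triples of
    vertices. *)
Lemma convex_pentagon_oriented (R : realType) (V : polygon R 5) :
  convex_polygon V -> exists2 s : R, s != 0 & oriented s V.
Proof.
move=> cV.
pose side s i := forall j, j != i -> j != ordS i ->
  0 < s * orient (V i) (V (ordS i)) (V j).
have cV' i : side 1 i \/ side (-1) i.
  have [h|h] := cV i; [left|right] => j ji jSi; first by rewrite mul1r h.
  by rewrite mulN1r oppr_gt0 h.
(* The triangle [V_i V_(i+1) V_(i+2)] lies on both sides [i] and [i + 1]. *)
have next s i : s = 1 \/ s = -1 -> side s i -> side s (ordS i).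
  move=> s1 si.
  have [Sii SSii SSiSi] : [/\ i != ordS i, ordS (ordS i) != i &
      ordS (ordS i) != ordS i].
    by case: i {si} => [[|[|[|[|[|]]]]]].
  have pos := si _ SSii SSiSi; rewrite orient_rot in pos.
  have iSS : i != ordS (ordS i) by rewrite eq_sym.
  case: (cV' (ordS i)) => h; case: s1 si pos => -> // _;
    have := h i Sii iSS; lra.
have [s s1 s_side] : exists2 s, s = 1 \/ s = -1 & side s (o5 0).
  by have [h|h] := cV' (o5 0); [exists 1|exists (-1)] => //; [left|right].
exists s; first by case: s1 => ->; rewrite ?oppr_eq0 oner_eq0.
have sides i : side s i.
  have s_1 := next _ _ s1 s_side; have s_2 := next _ _ s1 s_1.
  have s_3 := next _ _ s1 s_2; have s_4 := next _ _ s1 s_3.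
  rewrite !ordS_pentagon in s_1 s_2 s_3 s_4.
  by case: i => [[|[|[|[|[|//]]]]] i5]; rewrite (bool_irrelevance i5 isT).
have pos (i j k : 'I_5) : val (ordS i) = j -> k != i -> k != j ->
  0 < s * orient (V i) (V j) (V k).
  by move=> /val_inj <-; exact: sides.
move=> i j k /andP[ij jk]; have i5 := ltn_ord i; have k5 := ltn_ord k.
(* Among three of five vertices two are cyclically adjacent, so each triple is an instance of a side
   condition; in the last case [i] is 0 and [k] is 4. *)
have [jE|jNi] := eqVneq (j : nat) i.+1.
  by apply: pos; rewrite ?val_ordS -?val_eqE /=; try case: ifP; lia.
have [kE|kNj] := eqVneq (k : nat) j.+1.
  by rewrite orient_rot; apply: pos;
    rewrite ?val_ordS -?val_eqE /=; try case: ifP; lia.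
by rewrite -orient_rot; apply: pos;
  rewrite ?val_ordS -?val_eqE /=; try case: ifP; lia.
Qed.

Lemma oriented1_convex (R : realType) n (V : polygon R n) :
  oriented 1 V -> convex_polygon V.
Proof.
move=> oV i; left => j ji jSi.
have pos (x y z : 'I_n) : (x < y < z)%N -> 0 < orient (V x) (V y) (V z).
  by move=> /oV; rewrite mul1r.
move: ji jSi; rewrite -!val_eqE val_ordS /=.
have SE : ordS i = _ :> nat := val_ordS i.
have jn := ltn_ord j; move: SE; case: ifP => Sin SE ji jSi.
  have [ij|ji'] := ltnP i j; first by apply: pos; lia.
  by rewrite -orient_rot; apply: pos; lia.
by rewrite orient_rot; apply: pos; lia.
Qed.

(** Expanding the determinant in its three points gives eight determinants with positive
    coefficients. Moving indices one step on keeps the cyclic order weakly, so none is negative, and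
    the unshifted one is positive. *)
Lemma kasner_oriented (R : realType) n (m s : R) (V : polygon R n) :
  0 < m -> m < 1 -> oriented s V -> oriented s (kasner_descendant m V).
Proof.
move=> m0 m1 sV i j k ijk.
have m1' : 0 < 1 - m by rewrite subr_gt0.
rewrite /kasner_descendant; set i' := ordS i.
set j' := ordS j; set k' := ordS k.
have -> : s * orient (V i + m *: (V i' - V i)) (V j + m *: (V j' - V j))
      (V k + m *: (V k' - V k)) =
    (1 - m) ^+ 3 * (s * orient (V i) (V j) (V k))
  + (1 - m) ^+ 2 * m * (s * orient (V i') (V j) (V k)
      + s * orient (V i) (V j') (V k) + s * orient (V i) (V j) (V k'))
  + (1 - m) * m ^+ 2 * (s * orient (V i') (V j') (V k)
      + s * orient (V i') (V j) (V k') + s * orient (V i) (V j') (V k'))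
  + m ^+ 3 * (s * orient (V i') (V j') (V k')).
  by rewrite /orient /= -![_ *: _]/(_ * _); ring.
have i'E : i' = i.+1 :> nat.
  by rewrite [LHS]val_ordS; case: ifP; have := ltn_ord k; lia.
have j'E : j' = j.+1 :> nat.
  by rewrite [LHS]val_ordS; case: ifP; have := ltn_ord k; lia.
have ge0 (a b : 'I_n) : (a <= b <= k)%N -> 0 <= s * orient (V a) (V b) (V k).
  exact: oriented_ge0.
(* If [k] is the last index then [k'] is 0, and a rotation brings it to the front. *)
have ge0' (a b : 'I_n) : (a <= b <= j')%N -> 0 <= s * orient (V a) (V b) (V k').
  move=> abj; have : k' = _ :> nat := val_ordS k; case: ifP => kn k'E.
    by apply: oriented_ge0 => //; rewrite k'E; lia.
  by rewrite -orient_rot oriented_ge0 // k'E; lia.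
have pos : 0 < (1 - m) ^+ 3 * (s * orient (V i) (V j) (V k)).
  by rewrite mulr_gt0 ?exprn_gt0 // sV.
have [m_ge0 m'_ge0] : 0 <= m /\ 0 <= 1 - m by split; exact: ltW.
rewrite !ltr_wpDr //; (apply: mulr_ge0;
  first by rewrite ?mulr_ge0 ?exprn_ge0); rewrite ?addr_ge0 //;
  (apply: ge0 || apply: ge0'); lia.
Qed.

(** * Descendants *)

(* Twice the signed area, by triangulation from the vertex 0. *)
Definition fan (R : realType) (V : polygon R 5) : R :=
  orient (V (o5 0)) (V (o5 1)) (V (o5 2))
  + orient (V (o5 0)) (V (o5 2)) (V (o5 3))
  + orient (V (o5 0)) (V (o5 3)) (V (o5 4)).

Definition ears (R : realType) (V : polygon R 5) : R :=
  orient (V (o5 0)) (V (o5 1)) (V (o5 2))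
  + orient (V (o5 1)) (V (o5 2)) (V (o5 3))
  + orient (V (o5 2)) (V (o5 3)) (V (o5 4))
  + orient (V (o5 3)) (V (o5 4)) (V (o5 0))
  + orient (V (o5 4)) (V (o5 0)) (V (o5 1)).

(** The corner cut off at a vertex takes the fraction [1 - m] of the side before it and [m] of the
    side after it, hence [m * (1 - m)] of the ear there. *)
Lemma fan_kasner (R : realType) (m : R) (V : polygon R 5) :
  fan (kasner_descendant m V) = fan V - m * (1 - m) * ears V.
Proof.
rewrite /ears /fan /kasner_descendant !ordS_pentagon.
by rewrite /orient /= -![_ *: _]/(_ * _); ring.
Qed.

Lemma area_oriented (R : realType) (s : R) (V : polygon R 5) :
  oriented s V -> `|s| * area V = s * fan V / 2.
Proof.
move=> sV; have posE (i j k : 'I_5) : (i < j < k)%N ->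
    `|s| * `|orient (V i) (V j) (V k)| = s * orient (V i) (V j) (V k).
  by move=> ijk; rewrite -normrM gtr0_norm // sV.
rewrite (area_pentagon sV) mulrA; congr (_ / 2).
rewrite /fan [LHS]mulrDr [X in X + _]mulrDr.
by rewrite [RHS]mulrDr [X in _ = X + _]mulrDr !posE.
Qed.

Lemma fan_gt0 (R : realType) (s : R) (V : polygon R 5) :
  oriented s V -> 0 < s * fan V.
Proof. by move=> sV; rewrite /fan 2!mulrDr 2?addr_gt0 // sV. Qed.

(** Both bounds and both examples thereby reduce to the quotient [ears V / fan V]. *)
Lemma kasner_ratio (R : realType) (m s : R) (V : polygon R 5) :
  0 < m -> m < 1 -> s != 0 -> oriented s V ->
  area (kasner_descendant m V) / area V = 1 - m * (1 - m) * (ears V / fan V).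
Proof.
move=> m0 m1 s0 sV.
have fV0 : fan V != 0.
  by have := fan_gt0 sV; apply: contraTneq => ->; rewrite mulr0 ltxx.
have areaE W : oriented s W -> area W = s * fan W / (2 * `|s|).
  move=> /area_oriented E; apply: (mulfI (_ : `|s| != 0)).
    by rewrite normr_eq0.
  by rewrite E; field; rewrite normr_eq0.
rewrite !areaE //; last exact: kasner_oriented.
rewrite fan_kasner; field; rewrite ?normr_eq0 ?fV0 ?s0 /= ?s0 //.
Qed.

(** * Comparison of the ears with the area *)

Lemma gauss_pentagon (R : realType) (V : polygon R 5) :
  let e i := orient (V i) (V (ordS i)) (V (ordS (ordS i))) in
  fan V * (ears V - fan V) = e (o5 0) * e (o5 1) + e (o5 1) * e (o5 2)
    + e (o5 2) * e (o5 3) + e (o5 3) * e (o5 4) + e (o5 4) * e (o5 0).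
Proof. by rewrite /= !ordS_pentagon /fan /ears /orient; ring. Qed.

Lemma ears_gt_fan (R : realType) (s : R) (V : polygon R 5) :
  oriented s V -> s * fan V < s * ears V.
Proof.
move=> sV; have sF := fan_gt0 sV.
pose e i := orient (V i) (V (ordS i)) (V (ordS (ordS i))).
have e0 i : 0 < s * e i.
  have [] : [\/ i = o5 0, i = o5 1, i = o5 2 | i = o5 3] \/ i = o5 4.
    case: i => [[|[|[|[|[|//]]]]] i5]; rewrite (bool_irrelevance i5 isT);
      by [left; constructor | right].
  - case=> ->; rewrite /e !ordS_pentagon;
      by rewrite -?(orient_rot (V (o5 0))); apply: sV.
  - by move=> ->; rewrite /e !ordS_pentagon orient_rot; apply: sV.
(* Multiplying the difference by the positive [s * fan V] turns it into [s * s] times the left side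
   of the identity of Gauss, a sum of products of ears. *)
rewrite -subr_gt0 -mulrBr -(pmulr_rgt0 _ sF) mulrACA gauss_pentagon -!/(e _).
have ee i j : 0 < s * s * (e i * e j) by rewrite mulrACA mulr_gt0.
by rewrite 4!mulrDr 4?addr_gt0.
Qed.

Lemma ears_lt_2fan (R : realType) (s : R) (V : polygon R 5) :
  oriented s V -> s * ears V < 2 * (s * fan V).
Proof.
move=> sV.
pose o i j k := s * orient (V i) (V j) (V k).
have pos (i j k : 'I_5) : (i < j < k)%N -> 0 < o i j k := @sV i j k.
(* Cutting a quadrilateral along either diagonal expresses each triangle that avoids vertex 0 by
   triangles at vertex 0. *)
have o123 : o (o5 1) (o5 2) (o5 3) = o (o5 0) (o5 1) (o5 2)
    + o (o5 0) (o5 2) (o5 3) - o (o5 0) (o5 1) (o5 3).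
  by rewrite /o /orient; ring.
have o234 : o (o5 2) (o5 3) (o5 4) = o (o5 0) (o5 2) (o5 3)
    + o (o5 0) (o5 3) (o5 4) - o (o5 0) (o5 2) (o5 4).
  by rewrite /o /orient; ring.
have o124 : o (o5 1) (o5 2) (o5 4) = o (o5 0) (o5 1) (o5 2)
    + o (o5 0) (o5 2) (o5 4) - o (o5 0) (o5 1) (o5 4).
  by rewrite /o /orient; ring.
have o134 : o (o5 1) (o5 3) (o5 4) = o (o5 0) (o5 1) (o5 3)
    + o (o5 0) (o5 3) (o5 4) - o (o5 0) (o5 1) (o5 4).
  by rewrite /o /orient; ring.
have plucker : o (o5 0) (o5 1) (o5 4) * o (o5 0) (o5 2) (o5 3) =
    o (o5 0) (o5 2) (o5 4) * o (o5 0) (o5 1) (o5 3)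
    - o (o5 0) (o5 1) (o5 2) * o (o5 0) (o5 3) (o5 4).
  by rewrite /o /orient; ring.
have earsE : s * ears V = o (o5 0) (o5 1) (o5 2) + o (o5 1) (o5 2) (o5 3)
    + o (o5 2) (o5 3) (o5 4) + o (o5 0) (o5 3) (o5 4) + o (o5 0) (o5 1) (o5 4).
  by rewrite /o /ears /orient; ring.
have fanE : s * fan V = o (o5 0) (o5 1) (o5 2) + o (o5 0) (o5 2) (o5 3)
    + o (o5 0) (o5 3) (o5 4).
  by rewrite /o /fan /orient; ring.
rewrite earsE fanE o123 o234.
(* After these substitutions twice the fan minus the ears is 013 + 024 - 014. *)
suff : o (o5 0) (o5 1) (o5 4) < o (o5 0) (o5 1) (o5 3) + o (o5 0) (o5 2) (o5 4).
  by lra.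
(* Otherwise 013 < 012 and 024 < 034, and 023 is negative by [plucker]. *)
rewrite ltNge; apply/negP => le014.
have lt1 : o (o5 0) (o5 1) (o5 3) < o (o5 0) (o5 1) (o5 2).
  by have := pos (o5 1) (o5 2) (o5 4) isT; rewrite o124; lra.
have lt2 : o (o5 0) (o5 2) (o5 4) < o (o5 0) (o5 3) (o5 4).
  by have := pos (o5 1) (o5 3) (o5 4) isT; rewrite o134; lra.
have := ltr_pM (ltW (pos (o5 0) (o5 2) (o5 4) isT))
  (ltW (pos (o5 0) (o5 1) (o5 3) isT)) lt2 lt1.
rewrite [X in _ < X]mulrC -subr_lt0 -plucker ltNge.
by rewrite mulr_ge0 ?ltW ?pos.
Qed.

Lemma ears_bounds (R : realType) (s : R) (V : polygon R 5) : s != 0 ->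
  oriented s V -> 1 < ears V / fan V < 2.
Proof.
move=> s0 sV; have sF := fan_gt0 sV.
have -> : ears V / fan V = (s * ears V) / (s * fan V).
  by rewrite -mulf_div divff // mul1r.
by rewrite ltr_pdivlMr // ltr_pdivrMr // mul1r ears_gt_fan // ears_lt_2fan.
Qed.

(** * Extremal pentagons and the theorem *)

Definition pentagon (R : realType) (A B C D E : R * R) : polygon R 5 :=
  fun i => nth 0 [:: A; B; C; D; E] i.

Lemma pentagon_oriented (R : realType) (s : R) (A B C D E : R * R) :
  [/\ 0 < s * orient A B C, 0 < s * orient A B D, 0 < s * orient A B E,
    0 < s * orient A C D & 0 < s * orient A C E] ->
  [/\ 0 < s * orient A D E, 0 < s * orient B C D, 0 < s * orient B C E,
    0 < s * orient B D E & 0 < s * orient C D E] ->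
  oriented s (pentagon A B C D E).
Proof.
move=> [? ? ? ? ?] [? ? ? ? ?].
by case=> [[|[|[|[|[|//]]]]] ?]; case=> [[|[|[|[|[|//]]]]] ?];
  case=> [[|[|[|[|[|//]]]]] ?].
Qed.

Theorem theorem4p1 (R : realType) (m : R) (m_gt0 : 0 < m) (m_lt1 : m < 1) :
  [/\ forall K : polygon R 5, convex_polygon K ->
        1 - 2 * m * (1 - m) < area (kasner_descendant m K) / area K
          < 1 - m * (1 - m),
      forall e : R, 0 < e ->
        exists K : polygon R 5, convex_polygon K /\
          area (kasner_descendant m K) / area K < 1 - 2 * m * (1 - m) + e
    & forall e : R, 0 < e ->
        exists K : polygon R 5, convex_polygon K /\
          1 - m * (1 - m) - e < area (kasner_descendant m K) / area K].
Proof.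
have mm0 : 0 < m * (1 - m) by rewrite mulr_gt0 // subr_gt0.
(* This bound absorbs the constants in the error terms [3 * e] and [2 * d] of the two examples. *)
have mm1 : m * (1 - m) <= 1 / 4 by have := sqr_ge0 (m - 1 / 2); lra.
split=> [K /convex_pentagon_oriented[s s0 sK]|e e0|e e0].
- rewrite (kasner_ratio m_gt0 m_lt1 s0 sK).
  by have /andP[lt1 lt2] := ears_bounds s0 sK; apply/andP; split; nra.
(* As [e] tends to 0 the last three vertices merge at [(0, 1)], and the quotient of ears by fan is
   [2 - 3 * e] to first order. *)
- pose K := pentagon (0, 0) (1, 0) (2 * e, 1) (e, 1 + e) (0, 1) : polygon R 5.
  have oK : oriented 1 K.
    by apply: pentagon_oriented; rewrite /orient /= !mul1r; split; nra.
  have fK : fan K = 1 + 2 * e + 2 * e ^+ 2.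
    by rewrite /fan /K /pentagon /orient /=; ring.
  have eK : ears K = 2 + e + 4 * e ^+ 2.
    by rewrite /ears /K /pentagon /orient /=; ring.
  exists K; split; first exact: oriented1_convex.
  rewrite (kasner_ratio m_gt0 m_lt1 (oner_neq0 _) oK).
  have : 2 - 3 * e < ears K / fan K.
    rewrite ltr_pdivlMr fK ?eK; nra.
  nra.
(* This [d] is below both [e] and 1; the latter keeps the next pentagon, a unit square with one
   corner cut off, convex for every [e]. As [d] tends to 0 its second and third vertices merge, as
   do its last two, and the quotient is [1 + 2 * d] to first order. *)
- pose d := e / (1 + e).
  have d0 : 0 < d by rewrite divr_gt0 // addr_gt0.
  have d1 : d < 1 by rewrite ltr_pdivrMr; lra.
  have de : d < e by rewrite ltr_pdivrMr; nra.
  pose K := pentagon (0, 0) (1, 0) (1, d) (d, 1) (0, 1) : polygon R 5.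
  have oK : oriented 1 K.
    by apply: pentagon_oriented; rewrite /orient /= !mul1r; split; nra.
  have fK : fan K = 1 + 2 * d - d ^+ 2.
    by rewrite /fan /K /pentagon /orient /=; ring.
  have eK : ears K = 1 + 4 * d - 2 * d ^+ 2.
    by rewrite /ears /K /pentagon /orient /=; ring.
  exists K; split; first exact: oriented1_convex.
  rewrite (kasner_ratio m_gt0 m_lt1 (oner_neq0 _) oK).
  have : ears K / fan K < 1 + 2 * d.
    rewrite ltr_pdivrMr fK ?eK; nra.
  nra.
Qed.
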